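(* Let $(X,d)$ be a compact metric space. Let $T$ be a non-empty open subset of $X$ containing no isolated points. Suppose $H(X|T)$ has the following two properties: (A) for every $\epsilon>0$ and all distinct points $x_1,y_1,x_2,y_2,\dots,x_n,y_n$ of $T$ such that $d(x_i,y_i)<\epsilon$ for $i=1,\dots,n$, there exists $h\in B_\epsilon^{\tau_k}\cap H(X|T)$ such that $h(x_i)=y_i$ for $i=1,\dots,n$; (B) for every finite subset $F$ of $T$, the set $B_F^{\tau_p}\cap H(X|T)$ is highly transitive on $T\setminus F$. Then, if $\tau$ is a topological group topology on $H(X)$ with $\tau\subseteq\tau_p\cap\tau_k$, and $1\in U\in\tau$, then $\{1\}\ne H(X|T)\subseteq U$. Hence $H(X)$ does not have a minimum Hausdorff group topology.
   Context: $H(X)$ denotes the group of all homeomorphisms of $X$ onto itself under composition, with identity $1$. A topology on a group is a (topological) group topology if the group operations are continuous for it (it need not be Hausdorff). A minimum Hausdorff group topology on a group $G$ is a Hausdorff group topology on $G$ contained in every Hausdorff group topology on $G$. For a compact metric space $(X,d)$: $\tau_p$ is the pointwise topology on $H(X)$, the group topology whose basic neighborhoods of $1$ are the sets $B_F^{\tau_p}=\{f\in H(X): f(x)=x \text{ for all } x\in F\}$, for $F$ a finite subset of $X$; $\tau_k$ is the compact-open topology on $H(X)$, whose basic neighborhoods of $1$ are the sets $B_\epsilon^{\tau_k}=\{f\in H(X): d(f(x),x)<\epsilon\text{ for all }x\in X\}$, for $\epsilon>0$. For $S\subseteq X$, $H(X|S)=\{h\in H(X): h \text{ is the identity outside } S\}$.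 A set $A$ of permutations is highly transitive on a set $Y$ if for every $n\ge 1$ and any two $n$-tuples $(a_1,\dots,a_n)$, $(b_1,\dots,b_n)$ of pairwise distinct points of $Y$ there is $g\in A$ with $g(a_i)=b_i$ for all $i$. *)

(* Defs.v *)
From HB Require Import structures.
From mathcomp Require Import all_boot all_order all_algebra.
From mathcomp Require Import all_classical all_reals all_analysis.

Set Implicit Arguments.
Unset Strict Implicit.
Unset Printing Implicit Defensive.

Import Order.TTheory GRing.Theory Num.Theory.

Local Open Scope classical_set_scope.
Local Open Scope ring_scope.

Section Homeo.
Variable X : topologicalType.

Record homeo := Homeo {
  homeo_fun :> X -> X;
  homeo_inv : X -> X;
  homeo_funK : cancel homeo_fun homeo_inv;
  homeo_invK : cancel homeo_inv homeo_fun;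
  homeo_fun_continuous : continuous homeo_fun;
  homeo_inv_continuous : continuous homeo_inv }.

Lemma homeoP (f g : homeo) : f =1 g -> f = g.
Proof.
case: f g => [f f' fK f'K cf cf'] [g g' gK g'K cg cg'] /= fg.
have {}fg : f = g by apply/funext.
have fg' : f' = g'.
  by apply/funext => x; rewrite -[LHS]gK -fg f'K.
subst g g'; congr Homeo; exact: Prop_irrelevance.
Qed.

Definition homeo_id : homeo :=
  @Homeo idfun idfun (fun=> erefl) (fun=> erefl)
    (fun x => cvg_id) (fun x => cvg_id).

Definition homeo_opp (f : homeo) : homeo :=
  Homeo (homeo_invK f) (homeo_funK f)
    (@homeo_inv_continuous f) (@homeo_fun_continuous f).

Definition homeo_comp (f g : homeo) : homeo :=
  @Homeo (f \o g) (homeo_inv g \o homeo_inv f)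
    (can_comp (homeo_funK f) (homeo_funK g))
    (can_comp (homeo_invK g) (homeo_invK f))
    (fun x => continuous_comp (@homeo_fun_continuous g x)
                              (@homeo_fun_continuous f (g x)))
    (fun x => continuous_comp (@homeo_inv_continuous f x)
                              (@homeo_inv_continuous g (homeo_inv f x))).

Let homeo_compA : associative homeo_comp.
Proof. by move=> f g h; apply: homeoP. Qed.

Let homeo_comp1f : left_id homeo_id homeo_comp.
Proof. by move=> f; apply: homeoP. Qed.

Let homeo_compf1 : right_id homeo_id homeo_comp.
Proof. by move=> f; apply: homeoP. Qed.

Let homeo_compVf : left_inverse homeo_id homeo_opp homeo_comp.
Proof. by move=> f; apply: homeoP => x; exact: homeo_funK. Qed.

Let homeo_compfV : right_inverse homeo_id homeo_opp homeo_comp.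
Proof. by move=> f; apply: homeoP => x; exact: homeo_invK. Qed.

HB.instance Definition _ := gen_eqMixin homeo.
HB.instance Definition _ := gen_choiceMixin homeo.
HB.instance Definition _ := isGroup.Build homeo
  homeo_compA homeo_comp1f homeo_compf1 homeo_compVf homeo_compfV.

(* H(X|S) *)
Definition homeo_on (S : set X) : set homeo :=
  [set h | forall x, ~ S x -> h x = x].

Definition highly_transitive (A : set homeo) (Y : set X) : Prop :=
  forall (n : nat) (a b : 'I_n -> X), (0 < n)%N ->
    injective a -> injective b ->
    (forall i, Y (a i)) -> (forall i, Y (b i)) ->
    exists2 g : homeo, A g & forall i, g (a i) = b i.

End Homeo.

(* Topologies on a fixed group [G] are elements of [Topological G]; this
   lets several of them coexist and be compared. *)
Section GroupTopology.
Variable G : groupType.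

Definition opens (t : Topological G) : set_system G :=
  @open (Topological.Pack t).

(* No separation axiom is included. *)
Definition group_topology (t : Topological G) : Prop :=
  let T : topologicalType := Topological.Pack t in
  continuous (fun p : T * T => (p.1 : G) * (p.2 : G) : T)%g /\
  continuous (fun g : T => (g : G)^-1 : T)%g.

Definition hausdorff_group_topology (t : Topological G) : Prop :=
  group_topology t /\ hausdorff_space (Topological.Pack t).

Definition minimum_hausdorff_group_topology (t : Topological G) : Prop :=
  hausdorff_group_topology t /\
  forall t' : Topological G,
    hausdorff_group_topology t' -> opens t `<=` opens t'.

(* In a group topology for which the sets [B i], [i \in D], are a base of
   neighborhoods of 1, the right translates of the [B i] by [g] are a base of
   neighborhoods of [g]; hence these are its open sets. *)
Definition translate_open (I : Type) (D : set I) (B : I -> set G) :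
    set_system G :=
  [set U | forall g : G, U g ->
     exists2 i, D i & [set (b * g)%g | b in B i] `<=` U].

Section TranslateOpen.
Variables (I : Type) (D : set I) (B : I -> set G).

Lemma translate_openT : D !=set0 -> translate_open D B setT.
Proof. by move=> [i Di] g _; exists i. Qed.

Lemma translate_openI :
  (forall i j, D i -> D j -> exists2 k, D k & B k `<=` B i `&` B j) ->
  setI_closed (translate_open D B).
Proof.
move=> BI U V Uo Vo g [/Uo[i Di iU] /Vo[j Dj jV]].
have [k Dk kij] := BI _ _ Di Dj; exists k => // _ [b /kij[bi bj] <-].
by split; [apply: iU; exists b|apply: jV; exists b].
Qed.

Lemma translate_open_bigU (J : Type) (f : J -> set G) :
  (forall j, translate_open D B (f j)) -> translate_open D B (\bigcup_j f j).
Proof.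
move=> fo g [j _ /fo[i Di iU]]; exists i => // h /iU fh.
by exists j.
Qed.

End TranslateOpen.
End GroupTopology.

Section PointwiseTopology.
Variable X : topologicalType.

Definition pointwise_ball (F : set X) : set (homeo X) :=
  [set f | forall x, F x -> f x = x].

Definition pointwise_homeo : Type := homeo X.

Let pointwise_open : set_system (homeo X) :=
  translate_open (@finite_set X) pointwise_ball.

Let pointwise_openT : pointwise_open setT.
Proof. by apply: translate_openT; exists set0; exact: finite_set0. Qed.

Let pointwise_openI : setI_closed pointwise_open.
Proof.
apply: translate_openI => E F fE fF; exists (E `|` F).
  by rewrite /= finite_setU.
by move=> f fEF; split=> x ?; apply: fEF; [left|right].
Qed.

HB.instance Definition _ := Choice.copy pointwise_homeo (homeo X).
HB.instance Definition _ := isOpenTopological.Build pointwise_homeo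
  pointwise_openT pointwise_openI
  (@translate_open_bigU _ _ (@finite_set X) pointwise_ball).

(* tau_p: pointwise convergence with the range [X] taken discrete. *)
Definition pointwise_topology : Topological (homeo X) :=
  Topological.class pointwise_homeo.

End PointwiseTopology.

Section CompactOpenTopology.
Variables (R : realType) (X : metricType R).

Definition compact_open_ball (e : R) : set (homeo X) :=
  [set f | forall x, mdist (f x) x < e].

Definition compact_open_homeo : Type := homeo X.

Let posR : set R := [set e | 0 < e].

Let co_open : set_system (homeo X) := translate_open posR compact_open_ball.

Let co_openT : co_open setT.
Proof. by apply: translate_openT; exists 1; exact: ltr01. Qed.

Let co_openI : setI_closed co_open.
Proof.
apply: translate_openI => e e' e0 e'0; exists (Num.min e e').
  by rewrite /posR /= lt_min e0.
by move=> f fe; split=> x; have := fe x; rewrite lt_min => /andP[].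
Qed.

HB.instance Definition _ := Choice.copy compact_open_homeo (homeo X).
HB.instance Definition _ := isOpenTopological.Build compact_open_homeo
  co_openT co_openI (@translate_open_bigU _ _ posR compact_open_ball).

(* tau_k: the right translates of the [compact_open_ball e] are the balls of
   the sup distance; a group topology when [X] is compact. *)
Definition compact_open_topology : Topological (homeo X) :=
  Topological.class compact_open_homeo.

End CompactOpenTopology.

(* Main.v *)
Require Import Defs.
From HB Require Import structures.
From mathcomp Require Import all_boot all_order all_algebra.
From mathcomp Require Import all_classical all_reals all_analysis.

Set Implicit Arguments.
Unset Strict Implicit.
Unset Printing Implicit Defensive.

Import Order.TTheory GRing.Theory Num.Theory.

Local Open Scope classical_set_scope.
Local Open Scope ring_scope.

(** Why it is true.  Let [W] be a neighborhood of 1 for [t] such that products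
    of four elements of [W] lie in [U].  Since [t] is coarser than both
    topologies, [W] contains every homeomorphism fixing some finite set [F]
    pointwise, and every homeomorphism moving all points by less than some
    [e > 0].  An element [h] of H(X|T) is then written as [f1 * f2 * (f3 * f4)]
    with all factors in [W]: if [a] enumerates [F `&` T], property (A) moves
    each [a i] by less than [e] to a point [x i] outside [F], and moves a point
    [y i] outside [F] by less than [e] to [h (a i)]; property (B) moves [x] to
    [y] while fixing [F].  The product of these three moves agrees with [h] on
    [F], so what remains of [h] fixes [F].  This is [homeo_on_decompose]; the
    intermediate points [x i] and [y i] can be taken distinct and away from any
    finite set because nonempty open subsets of [T] are infinite
    ([nonisolated_nbhs_infinite], [infinite_distinct_representatives]).

    So no group topology below both topologies separates 1 from the nontrivial
    group H(X|T).  As both are Hausdorff group topologies (compactness of [X]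
    enters through uniform continuity, for [tau_k]), a minimum one would be
    below both and yet Hausdorff, a contradiction. *)

(** * Group topologies given by the neighborhoods of 1 *)

(** Closure under conjugation lets right translates serve as left ones, so
    these conditions make the topology of right translates a group topology. *)
Record group_base (G : groupType) (I : Type) (D : set I) (B : I -> set G) :
    Prop := GroupBase {
  group_base1 : forall i, D i -> B i 1%g;
  group_baseM : forall i, D i ->
    exists2 j, D j & forall b c, B j b -> B j c -> B i (b * c)%g;
  group_baseV : forall i, D i -> exists2 j, D j & forall b, B j b -> B i b^-1%g;
  group_baseJ : forall g i, D i ->
    exists2 j, D j & forall b, B j b -> B i (g * b * g^-1)%g }.

(** Points having a basic translate inside [A] form an open set, because basic
    sets contain products of smaller ones; this makes every translate of a
    basic set, itself perhaps not open, a neighborhood. *)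
Lemma nbhs_translate_open (G : groupType) (I : Type) (D : set I)
    (B : I -> set G) (t : Topological G) :
  group_base D B -> opens t = translate_open D B ->
  forall (g : Topological.Pack t) (A : set (Topological.Pack t)),
  nbhs g A <-> exists2 i, D i & forall b, B i b -> A ((b : G) * (g : G))%g.
Proof.
move=> gB tE g A; rewrite nbhsE; split.
  move=> [U [Uo Ug] UA]; have : opens t U by [].
  rewrite tE => /(_ g Ug)[i Di BiU].
  by exists i => // b bi; apply/UA/BiU; exists b.
move=> [i Di iA].
exists [set h : G | exists2 j, D j & forall b, B j b -> A (b * h)%g]; last first.
  by move=> h [j Dj jA]; have := jA 1%g (group_base1 gB Dj); rewrite mul1g.
split; last by exists i.
suff : opens t [set h : G | exists2 j, D j & forall b, B j b -> A (b * h)%g] by [].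
rewrite tE => h [j Dj jA]; have [k Dk kj] := group_baseM gB Dj.
exists k => // _ [c ck <-]; exists k => // b bk.
by rewrite mulgA; apply/jA/kj.
Qed.

Lemma translate_open_group_topology (G : groupType) (I : Type) (D : set I)
    (B : I -> set G) (t : Topological G) :
  group_base D B -> opens t = translate_open D B -> group_topology t.
Proof.
move=> gB tE; have nbE := nbhs_translate_open gB tE.
split=> [[f g]|g] A /= /nbE[i Di iA].
  have [j Dj ji] := group_baseM gB Di.
  have [k Dk kj] := group_baseJ gB f Dj.
  exists ([set (b * (f : G))%g | b in B j], [set (c * (g : G))%g | c in B k]).
    by split; apply/nbE; [exists j|exists k] => // b ?; exists b.
  move=> [_ _] [/= [b bj <-] [c ck <-]] /=.
  have -> : (b * (f : G) * (c * (g : G)) =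
      b * (f * c * f^-1) * ((f : G) * (g : G)))%g by rewrite !mulgA mulgVK.
  by apply/iA/ji => //; exact: kj.
have [j Dj ji] := group_baseJ gB (g : G)^-1%g Di.
have [k Dk kj] := group_baseV gB Dj.
apply/nbE; exists k => // b bk /=.
have -> : ((b * (g : G))^-1 = (g : G)^-1 * b^-1 * ((g : G)^-1)^-1 * (g : G)^-1)%g.
  by rewrite invgM invgK mulgK.
by apply/iA/ji/kj.
Qed.

(** If translates [B j * f] and [B k * g] meet then [g / f] lies in
    [(B k)^-1 * B j], which is inside a basic set chosen to avoid it. *)
Lemma translate_open_hausdorff (G : groupType) (I : Type) (D : set I)
    (B : I -> set G) (t : Topological G) :
  group_base D B -> opens t = translate_open D B ->
  (forall g, g <> 1%g -> exists2 i, D i & ~ B i g) ->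
  hausdorff_space (Topological.Pack t).
Proof.
move=> gB tE sepB f g fg; apply: contrapT => fNg.
have nbE := nbhs_translate_open gB tE.
have [|i Di iN] := sepB ((g : G) * (f : G)^-1)%g.
  by move=> /divg1_eq gf; apply: fNg.
have [j Dj ji] := group_baseM gB Di.
have [k Dk kj] := group_baseV gB Dj.
have [||h [[b bj bh] [c ck ch]]] :=
    fg [set (b * (f : G))%g | b in B j] [set (c * (g : G))%g | c in B k].
- by apply/nbE; exists j => // b bj; exists b.
- by apply/nbE; exists k => // c ck; exists c.
apply: iN.
have -> : ((g : G) * (f : G)^-1 = c^-1 * b)%g.
  by apply: (mulgI c); rewrite mulVKg mulgA ch -bh mulgK.
by apply: ji => //; exact: kj.
Qed.

(** Continuity of the product at (1, 1). *)
Lemma group_topology_square (G : groupType) (t : Topological G) (U : set G) :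
  group_topology t -> opens t U -> U 1%g ->
  exists V : set G, [/\ opens t V, V 1%g & forall a b, V a -> V b -> U (a * b)%g].
Proof.
move=> [cM _] Uo U1.
have := cM (1%g, 1%g) U; rewrite /= mulg1 => /(_ (open_nbhs_nbhs (conj Uo U1))).
case=> -[P Q] /= [P1 Q1] PQU; move: P1 Q1.
rewrite (nbhsE (1%g : Topological.Pack t)) => -[P' [oP' P1] P'P] [Q' [oQ' Q1] Q'Q].
exists (P' `&` Q'); split; [exact: (@openI (Topological.Pack t))|by []|].
by move=> a b [Pa _] [_ Qb]; apply: (PQU (a, b)); split; [exact: P'P|exact: Q'Q].
Qed.

(** * The topologies tau_p and tau_k *)

(** Conjugating by [g] the homeomorphisms that fix [F] gives those that fix the
    image of [F], hence the base at [g^-1 F]. *)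
Lemma pointwise_group_base (X : topologicalType) :
  group_base (@finite_set X) (@pointwise_ball X).
Proof.
split=> [F _ //|F fF|F fF|g F fF].
- by exists F => // b c bF cF x Fx; rewrite [LHS](_ : _ = b (c x))// cF ?bF.
- by exists F => // b bF x Fx; rewrite -{1}(bF x Fx); exact: homeo_funK.
- exists (homeo_inv g @` F); first exact: finite_image.
  move=> b bF x Fx; rewrite [LHS](_ : _ = g (b (homeo_inv g x)))//.
  by rewrite bF; [exact: homeo_invK|exists x].
Qed.

Lemma homeo_neq1 (X : topologicalType) (g : homeo X) :
  g <> 1%g -> exists x, g x <> x.
Proof.
by move=> gN1; apply/existsNP => g1; apply: gN1; exact: homeoP.
Qed.

Lemma pointwise_hausdorff_group_topology (X : topologicalType) :
  hausdorff_group_topology (pointwise_topology X).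
Proof.
have gB := @pointwise_group_base X.
split; first exact: (translate_open_group_topology gB).
apply: (translate_open_hausdorff gB) => // g /homeo_neq1[x gx].
by exists [set x]; [exact: finite_set1|move/(_ x erefl)].
Qed.

(** The continuity bounds at the various points are made uniform by the
    near-covering form of compactness: it suffices to find, near each [x], a
    bound valid for all small [d]; half of the bound at [x] works. *)
Lemma compact_uniform_continuity (R : realType) (X Y : metricType R)
    (g : X -> Y) : compact [set: X] -> continuous g ->
  forall e : R, 0 < e -> exists2 d : R, 0 < d &
    forall x y, mdist x y < d -> mdist (g x) (g y) < e.
Proof.
move=> /compact_near_coveringP cX cg e e0.
have [|d [d0 dP]] := @filter_ex _ (0 : R)^'+ _
    [set d | 0 < d /\ forall x y, mdist x y < d -> mdist (g x) (g y) < e].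
- apply: filterI; first exact: nbhs_right_gt.
  have e20 : 0 < e / 2 by rewrite divr_gt0.
  have : \forall d \near (0 : R)^'+, [set: X] `<=`
      (fun x => forall y, mdist x y < d -> mdist (g x) (g y) < e).
    apply: cX => x _.
    have /nbhs_ballP[d /= d0 dx] := cg x _ (nbhsx_ballx (g x) _ e20).
    have d20 : 0 < d / 2 by rewrite divr_gt0.
    exists (ball x (d / 2), [set r | r < d / 2]).
      by split; [exact: nbhsx_ballx|exact: nbhs_right_lt].
    move=> [y r] [/= xy rd] z yz.
    have yz2 : ball y (d / 2) z by rewrite ballEmdist /= (lt_trans yz).
    have gy : ball (g x) (e / 2) (g y).
      by apply: dx; apply: le_ball xy; rewrite ler_pdivrMr// ler_pMr// ler1n.
    have gz : ball (g x) (e / 2) (g z).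
      by apply: dx; have := ball_triangle xy yz2; rewrite -splitr.
    by have := ball_triangle (ball_sym gy) gz; rewrite -splitr ballEmdist.
  by apply: filterS => d dP x y; exact: dP.
- by exists d.
Qed.

(** Compactness gives closure under conjugation: [g b g^-1] is uniformly close
    to 1 when [b] is, because [g] is uniformly continuous. *)
Lemma compact_open_group_base (R : realType) (X : metricType R) :
  compact [set: X] ->
  group_base [set e : R | 0 < e] (@compact_open_ball R X).
Proof.
move=> cX; split=> [e /= e0 x|e /= e0|e /= e0|g e /= e0].
- by rewrite mdistxx.
- exists (e / 2) => [|b c be ce x]; first by rewrite /= divr_gt0.
  rewrite [X in mdist X _](_ : _ = b (c x))// (splitr e).
  by rewrite (le_lt_trans (metric_triangle _ (c x) _))// ltrD.
- exists e => // b be x; have := be (homeo_inv b x).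
  by rewrite homeo_invK metric_sym.
- have [d d0 dg] := compact_uniform_continuity cX (@homeo_fun_continuous _ g) e0.
  exists d => // b bd x.
  rewrite [X in mdist X _](_ : _ = g (b (homeo_inv g x)))//.
  by rewrite -{2}(homeo_invK g x); exact/dg/bd.
Qed.

Lemma compact_open_hausdorff_group_topology (R : realType) (X : metricType R) :
  compact [set: X] -> hausdorff_group_topology (compact_open_topology X).
Proof.
move=> cX; have gB := compact_open_group_base cX.
split; first exact: (translate_open_group_topology gB).
apply: (translate_open_hausdorff gB) => // g /homeo_neq1[x gx].
exists (mdist (g x) x); first by rewrite /= mdist_gt0; exact/eqP.
by move=> /(_ x); rewrite ltxx.
Qed.

(** * Choosing points *)

(** In a T1 space, removing from a finite neighborhood of [x] its other points
    leaves a neighborhood, which isolates [x]. *)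
Lemma nonisolated_nbhs_infinite (X : topologicalType) (x : X) (U : set X) :
  accessible_space X -> ~ isolated [set: X] x -> nbhs x U -> infinite_set U.
Proof.
move=> X1 xNiso Ux finU; apply: xNiso; split; first by rewrite inE.
exists (U `&` ~` (U `\ x)); last first.
  rewrite setIT; apply/seteqP; split=> [y [Uy Uxy]|_ ->] /=.
    by apply: contrapT => yx; exact: Uxy.
  by split=> [|[]//]; exact: nbhs_singleton.
apply: filterI => //; apply: open_nbhs_nbhs; split; last by move=> [_]; apply.
apply: closed_openC; move/accessible_finite_set_closed: X1; apply.
exact: finite_setD.
Qed.

Lemma infinite_distinct_representatives (X : Type) (n : nat)
    (P : 'I_n -> set X) : (forall i, infinite_set (P i)) ->
  exists2 x : 'I_n -> X, injective x & forall i, P i (x i).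
Proof.
elim: n P => [|n IHn] P infP.
  have x0 : 'I_0 -> X by case.
  by exists x0 => -[].
have [x xI xP] := IHn (fun i => P (lift ord0 i)) (fun i => infP _).
have finx : finite_set (range x) by exact: finite_image.
have [y [Py xNy]] := infinite_setN0 (infinite_setD (infP ord0) finx).
exists (fun i => oapp x y (unlift ord0 i)) => [i j|i].
  case: unliftP => [i' ->|->]; case: unliftP => [j' ->|->] //= ij.
  - by congr lift; exact: xI.
  - by case: xNy; exists i'.
  - by case: xNy; exists j'.
by case: unliftP => [i' ->|->].
Qed.

Lemma finite_set_enum (X : choiceType) (F : set X) : finite_set F ->
  exists n (a : 'I_n -> X), injective a /\ F = range a.
Proof.
move=> /finite_seqP[s ->]; exists (size (undup s)), (tnth (in_tuple (undup s))).
split; first exact/tuple_uniqP/undup_uniq.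
apply/seteqP; split=> [x /= xs|_ [i _ <-]] /=.
  have /tnthP[i ->] : x \in in_tuple (undup s) by rewrite mem_undup.
  by exists i.
by rewrite -mem_undup mem_tnth.
Qed.

(** * Decomposing the elements of H(X|T) *)

Section HomeoOn.
Variables (X : topologicalType) (T : set X).

Lemma homeo_onM (f g : homeo X) :
  homeo_on T f -> homeo_on T g -> homeo_on T (f * g)%g.
Proof. by move=> fT gT x Tx; rewrite [LHS](_ : _ = f (g x))// gT ?fT. Qed.

Lemma homeo_onV (f : homeo X) : homeo_on T f -> homeo_on T f^-1%g.
Proof. by move=> fT x Tx; rewrite -{1}(fT x Tx); exact: homeo_funK. Qed.

Lemma homeo_on_preserves (f : homeo X) x : homeo_on T f -> T x -> T (f x).
Proof.
move=> fT Tx; apply: contrapT => /[dup] Tfx /(homeo_onV fT).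
by rewrite [LHS](_ : _ = x); [move=> xfx; apply: Tfx; rewrite -xfx|exact: homeo_funK].
Qed.

(** [E] stands for a set of small homeomorphisms: the second hypothesis says
    that any finite configuration in [T] can be moved off any finite set and
    back by elements of [E].  Two such moves with a transitivity move in between
    imitate [h] on [F], up to a factor fixing [F]. *)
Lemma homeo_on_decompose (E : set (homeo X)) :
  (forall F, finite_set F -> F `<=` T ->
     highly_transitive (pointwise_ball F `&` homeo_on T) (T `\` F)) ->
  (forall n (x : 'I_n -> X) (S : set X), (0 < n)%N -> injective x ->
     (forall i, T (x i)) -> finite_set S ->
     exists2 y : 'I_n -> X, injective y /\ (forall i, (T `\` S) (y i)) & (
     (exists2 f, (E `&` homeo_on T) f & forall i, f (x i) = y i) /\
     (exists2 f, (E `&` homeo_on T) f & forall i, f (y i) = x i))) ->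
  forall (F : set X) (h : homeo X), finite_set F -> homeo_on T h -> E 1%g ->
  exists f1 f2 f3 f4 : homeo X,
    [/\ h = (f1 * f2 * (f3 * f4))%g, E f1, pointwise_ball F f2,
        E f3 & pointwise_ball F f4].
Proof.
move=> transT nearT F h finF hT E1.
have fixT f : homeo_on T f -> pointwise_ball (F `&` T) f -> pointwise_ball F f.
  by move=> fT fF x Fx; have [Tx|/fT//] := pselect (T x); exact: fF.
have [|n [a [aI Fa]]] := @finite_set_enum X (F `&` T); first exact: finite_setIl.
have aT i : T (a i) by have : range a (a i) by []; rewrite -Fa => -[].
have finFT : finite_set (F `&` T) by exact: finite_setIl.
(* Both hypotheses speak of nonempty tuples only; when [F] misses [T], [h]
   itself fixes [F]. *)
have [n0|n0] := posnP n.
  exists 1%g, 1%g, 1%g, h; rewrite !mul1g; split=> //; apply: fixT => // x.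
  by rewrite Fa => -[i]; exfalso; move: i; rewrite n0 => -[].
have [x [xI xT] [[k1 [Ek1 k1T] k1x] _]] := nearT n a _ n0 aI aT finFT.
(* [y] is chosen close to the target [h \o a], not to the source [a]. *)
have haI : injective (h \o a).
  by move=> i j /= /(can_inj (homeo_funK h)); exact: aI.
have haT i : T ((h \o a) i) by exact: homeo_on_preserves.
have [y [yI yT] [_ [k2 [Ek2 k2T] k2y]]] := nearT n (h \o a) _ n0 haI haT finFT.
have [f [fF fT] fxy] := transT _ finFT (@subIsetr _ _ _) n x y n0 xI yI xT yT.
exists k2, f, k1, ((k2 * f * k1)^-1 * h)%g.
have kT : homeo_on T (k2 * f * k1)%g by do !apply: homeo_onM.
split=> //; [by rewrite !mulgA mulgV mul1g|exact: fixT|].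
apply: fixT; first exact/homeo_onM/hT/homeo_onV.
rewrite Fa => _ [i _ <-].
have hk : h (a i) = (k2 * f * k1)%g (a i).
  by rewrite [RHS](_ : _ = k2 (f (k1 (a i))))// k1x fxy k2y.
rewrite [LHS](_ : _ = (k2 * f * k1)^-1%g (h (a i)))// hk; exact: homeo_funK.
Qed.

End HomeoOn.

Theorem theorem1 (R : realType) (X : metricType R) (T : set X)
  (cptX : compact [set: X])
  (oT : open T) (T0 : T !=set0)
  (Tiso : forall x, T x -> ~ isolated [set: X] x)
  (propA : forall (e : R) (n : nat) (x y : 'I_n -> X),
     0 < e -> (0 < n)%N ->
     injective x -> injective y -> (forall i j, x i <> y j) ->
     (forall i, T (x i)) -> (forall i, T (y i)) ->
     (forall i, mdist (x i) (y i) < e) ->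
     exists2 h : homeo X, (compact_open_ball e `&` homeo_on T) h
       & forall i, h (x i) = y i)
  (propB : forall F : set X, finite_set F -> F `<=` T ->
     highly_transitive (pointwise_ball F `&` homeo_on T) (T `\` F)) :
  (forall (t : Topological (homeo X)) (U : set (homeo X)),
     group_topology t ->
     opens t `<=` opens (pointwise_topology X)
                  `&` opens (compact_open_topology X) ->
     opens t U -> U 1%g ->
     [set 1%g] <> homeo_on T /\ homeo_on T `<=` U) /\
  ~ (exists t : Topological (homeo X), minimum_hausdorff_group_topology t).
Proof.
have X1 : accessible_space X by exact/hausdorff_accessible/metric_hausdorff.
have onT_neq1 : exists2 h : homeo X, homeo_on T h & h <> 1%g.
  have [x Tx] := T0.
  have infT := nonisolated_nbhs_infinite X1 (Tiso x Tx)
    (open_nbhs_nbhs (conj oT Tx)).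
  have [y [Ty yx]] := infinite_setN0 (infinite_setD infT (finite_set1 x)).
  have [|||||h [_ hT] hxy] := propB _ (@finite_set0 X) (@sub0set _ T) 1%N
    (fun=> x) (fun=> y).
  - by [].
  - by move=> i j _; rewrite !ord1.
  - by move=> i j _; rewrite !ord1.
  - by split.
  - by split.
  - by exists h => // h1; apply: yx; rewrite /= -(hxy ord0) h1.
have onT_sub (t : Topological (homeo X)) (U : set (homeo X)) :
    group_topology t ->
    opens t `<=` opens (pointwise_topology X)
                 `&` opens (compact_open_topology X) ->
    opens t U -> U 1%g -> homeo_on T `<=` U.
  move=> gt tpk tU U1 h hT.
  have [V [tV V1 VU]] := group_topology_square gt tU U1.
  have [W [tW W1 WV]] := group_topology_square gt tV V1.
  have [/(_ _ W1)[F finF FW] /(_ _ W1)[e e0 eW]] := tpk _ tW.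
  have pF f : pointwise_ball F f -> W f.
    by move=> fF; apply: FW; exists f => //; rewrite mulg1.
  have ke f : compact_open_ball e f -> W f.
    by move=> fe; apply: eW; exists f => //; rewrite mulg1.
  have [||f1 [f2 [f3 [f4 [-> ? ? ? ?]]]]] :=
      @homeo_on_decompose X T (compact_open_ball e) propB _ F h finF hT.
  - move=> n x S n0 xI xT finS.
    (* The range of [x] is removed too, since (A) needs sources and targets
       to be disjoint. *)
    have infP i : infinite_set ((T `&` ball (x i) e) `\` (S `|` range x)).
      apply: infinite_setD.
        apply: (nonisolated_nbhs_infinite X1 (Tiso _ (xT i))).
        by apply: filterI; [exact: open_nbhs_nbhs|exact: nbhsx_ballx].
      by rewrite finite_setU; split=> //; exact: finite_image.
    have [y yI yP] := infinite_distinct_representatives infP.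
    have yT i : T (y i) by have [[]] := yP i.
    have yS i : ~ S (y i) by have [_ /not_orP[]] := yP i.
    have xy i : mdist (x i) (y i) < e.
      by have [[_]] := yP i; rewrite ballEmdist.
    have xNy i j : x i <> y j.
      by have [_ /not_orP[_ yx]] := yP j => xyij; apply: yx; exists i.
    exists y; first by split=> // i; split.
    split; first exact: propA.
    apply: propA => // [i j yx|i]; first exact: (xNy j i).
    by rewrite metric_sym.
  - by move=> x; rewrite mdistxx.
  - by apply: VU; apply: WV; auto.
split=> [t U gt tpk tU U1|[t [[gt ht] tmin]]].
  split; last exact: onT_sub tU U1.
  have [h hT hN1] := onT_neq1.
  by move=> T1; apply: hN1; move: hT; rewrite -T1.
have [h hT hN1] := onT_neq1.
have tpk : opens t `<=` opens (pointwise_topology X)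
                  `&` opens (compact_open_topology X).
  move=> U tU; split; apply: tmin tU.
    exact: pointwise_hausdorff_group_topology.
  exact: compact_open_hausdorff_group_topology.
move: ht; rewrite open_hausdorff => /(_ 1%g h)[].
  by apply/eqP => h1; apply: hN1.
move=> [U V] [/set_mem U1 /set_mem Vh] [tU _ /eqP UV0].
have Uh : U h by exact: (onT_sub t U gt tpk tU U1 h hT).
have : (U `&` V) h by [].
by rewrite UV0.
Qed.
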